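(* Let $\alpha$ and $\beta$ be non-zero complex numbers. For any solution $(p,q)$ to $$( * )\qquad p(u)q(u)=p(u+\beta)q(u+\alpha),$$ in which $p,q\in\mathbb{C}[u]$ are non-zero and monic, there exists a unique finite subset $C\subseteq\mathbb{C}/(\mathbb{Z}\alpha+\mathbb{Z}\beta)$, and unique $c$-integral solutions $(p_c,q_c)\neq (1,1)$ to $( * )$ for $c\in C$, such that $$(p,q)=\prod_{c\in C} (p_c,q_c).$$
   Context: Products of pairs are componentwise in $\mathbb{C}[u]\times\mathbb{C}[u]$. For a coset $c\in\mathbb{C}/(\mathbb{Z}\alpha+\mathbb{Z}\beta)$, a solution $(p,q)$ to $( * )$ in which $p$ and $q$ are non-zero and monic is called $c$-integral if every zero of $p(u)q(u)$ belongs to the coset $c$. *)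

(* Defs.v *)
From HB Require Import structures.
From mathcomp Require Import all_boot all_order all_algebra.
From mathcomp Require Import generic_quotient ring_quotient finmap complex.
From mathcomp Require Import boolp reals.

Set Implicit Arguments.
Unset Strict Implicit.
Unset Printing Implicit Defensive.

Import GRing.Theory Num.Theory.
Local Open Scope ring_scope.
Local Open Scope complex_scope.
Local Open Scope quotient_scope.

Section IntegralSolutions.
Variables (R : realType) (alpha beta : R[i]).

(* The additive subgroup Z alpha + Z beta of the complex numbers;
   it need not be discrete. *)
Definition period_group : {pred R[i]} :=
  [pred z | `[< exists m n : int, z = alpha *~ m + beta *~ n >]].

Lemma period_group_zmod_closed : zmod_closed period_group.
Proof.
split=> [|x y].
  by rewrite inE; apply/asboolP; exists 0, 0; rewrite !mulr0z addr0.
rewrite !inE => /asboolP[m [n ->]] /asboolP[m' [n' ->]].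
by apply/asboolP; exists (m - m'), (n - n'); rewrite !mulrzBr opprD addrACA.
Qed.

HB.instance Definition _ :=
  GRing.isZmodClosed.Build R[i] period_group period_group_zmod_closed.

Notation cosets := (Quotient.quot period_group).

Definition solution (p q : {poly R[i]}) : Prop :=
  p * q = (p \Po ('X + beta%:P)) * (q \Po ('X + alpha%:P)).

Definition integral_solution (c : cosets) (p q : {poly R[i]}) : Prop :=
  [/\ solution p q, p != 0 /\ q != 0, p \is monic /\ q \is monic &
      forall z : R[i], root (p * q) z -> \pi_cosets z = c].

(* The product is taken in the product ring {poly R[i]} * {poly R[i]}, whose
   multiplication is componentwise. Only the restriction of the family pq to C
   is relevant. *)
Definition integral_factorization (p q : {poly R[i]}) (C : {fset cosets})
    (pq : cosets -> {poly R[i]} * {poly R[i]}) : Prop :=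
  (forall c, c \in C ->
     integral_solution c (pq c).1 (pq c).2 /\ pq c <> (1, 1)) /\
  (p, q) = \prod_(c <- C) pq c.

End IntegralSolutions.

Notation cosets alpha beta := (Quotient.quot (period_group alpha beta)).

(* Main.v *)
(* The class of a zero modulo Z alpha + Z beta is unchanged by the shifts
   u -> u + alpha and u -> u + beta. Hence the operation sending a monic
   polynomial to the product of its linear factors with zeros in a fixed coset c
   is multiplicative and commutes with these shifts, so it maps solutions of the
   equation to solutions. This gives existence; uniqueness follows by applying
   the same operation to an arbitrary factorization, where it extracts the factor
   with index c. *)
Require Import Defs.
From mathcomp Require Import all_boot all_order all_algebra.
From mathcomp Require Import generic_quotient ring_quotient finmap complex.
From mathcomp Require Import boolp reals.

Set Implicit Arguments.
Unset Strict Implicit.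
Unset Printing Implicit Defensive.

Import GRing.Theory.
Local Open Scope ring_scope.
Local Open Scope complex_scope.
Local Open Scope quotient_scope.

Lemma prod_pred1_seq (A : pzSemiRingType) (T : eqType) (r : seq T) (c : T)
    (G : T -> A) : uniq r -> c \in r -> \prod_(d <- r | d == c) G d = G c.
Proof.
by move=> r_uniq cr; rewrite -big_filter filter_pred1_uniq // big_seq1.
Qed.

Section RootPart.
Variable F : closedFieldType.
Implicit Types (p q : {poly F}) (s : seq F) (P : pred F).

(** Zeros with multiplicity, in an unspecified order; the leading coefficient is lost, so [p] is
    recovered only when monic. *)
Definition root_seq p : seq F := sval (closed_field_poly_normal p).

Lemma monic_root_seqE p :
  p \is monic -> p = \prod_(z <- root_seq p) ('X - z%:P).
Proof.
rewrite /root_seq; case: closed_field_poly_normal => s /= p_eq /monicP p_lead.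
by rewrite {1}p_eq p_lead scale1r.
Qed.

Lemma mem_root_seq p z : p \is monic -> (z \in root_seq p) = root p z.
Proof. by move=> /monic_root_seqE {2}->; rewrite root_prod_XsubC. Qed.

Definition root_part P p : {poly F} :=
  \prod_(z <- root_seq p | P z) ('X - z%:P).

Lemma root_part_monic P p : root_part P p \is monic.
Proof. exact: monic_prod_XsubC. Qed.

(** By unique factorization the chosen list of zeros is a permutation of [s], and the product is
    commutative. So any list of zeros may be used to compute [root_part]. *)
Lemma root_part_prod_XsubC P s :
  root_part P (\prod_(z <- s) ('X - z%:P)) = \prod_(z <- s | P z) ('X - z%:P).
Proof.
apply/perm_big/prod_XsubC_eq.
by rewrite -monic_root_seqE ?monic_prod_XsubC.
Qed.

Lemma root_root_part P p z :
  p \is monic -> root (root_part P p) z = P z && root p z.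
Proof.
move=> p_mon; rewrite /root_part -big_filter root_prod_XsubC mem_filter.
by rewrite mem_root_seq.
Qed.

Lemma root_partM P p q : p \is monic -> q \is monic ->
  root_part P (p * q) = root_part P p * root_part P q.
Proof.
move=> /monic_root_seqE {1}-> /monic_root_seqE {1}->.
by rewrite -big_cat root_part_prod_XsubC big_cat.
Qed.

Lemma root_part1 P : root_part P 1 = 1.
Proof. by have := root_part_prod_XsubC P [::]; rewrite !big_nil. Qed.

Lemma root_part_prod P (I : eqType) (r : seq I) (G : I -> {poly F}) :
  {in r, forall i, G i \is monic} ->
  root_part P (\prod_(i <- r) G i) = \prod_(i <- r) root_part P (G i).
Proof.
elim: r => [|i r IHr] G_mon; first by rewrite !big_nil root_part1.
have G_mon_r : {in r, forall j, G j \is monic}.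
  by move=> j jr; apply: G_mon; rewrite inE jr orbT.
rewrite !big_cons root_partM ?IHr ?G_mon ?mem_head //.
by rewrite big_seq; apply: monic_prod.
Qed.

Lemma root_part_id P p : p \is monic ->
  (forall z, root p z -> P z) -> root_part P p = p.
Proof.
move=> p_mon rootP; rewrite {2}(monic_root_seqE p_mon) /root_part.
rewrite big_mkcond; apply: eq_big_seq => z.
by rewrite mem_root_seq // => /rootP ->.
Qed.

Lemma root_part_eq1 P p : p \is monic ->
  (forall z, root p z -> ~~ P z) -> root_part P p = 1.
Proof.
move=> p_mon rootNP; rewrite /root_part big_mkcond big1_seq // => z.
by rewrite mem_root_seq // => /rootNP/negPf->.
Qed.

Lemma prod_XsubC_shift s (P : pred F) a :
  (\prod_(z <- s | P z) ('X - z%:P)) \Po ('X + a%:P) =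
  \prod_(z <- s | P z) ('X - (z - a)%:P).
Proof.
rewrite -[LHS]/(comp_poly _ _) rmorph_prod.
apply: eq_bigr => z _ /=.
by rewrite comp_polyB comp_polyX comp_polyC polyCB opprB addrA addrAC.
Qed.

Lemma monic_shift p a : p \is monic -> p \Po ('X + a%:P) \is monic.
Proof.
by move=> /monic_root_seqE->; rewrite prod_XsubC_shift monic_prod_XsubC.
Qed.

(** The zeros of p(u + a) are the z - a with z a zero of p. The left side tests [P] at z - a, the
    right side at z, and periodicity of [P] makes the tests agree. *)
Lemma root_part_shift P p a : p \is monic ->
  (forall z, P (z - a) = P z) ->
  root_part P (p \Po ('X + a%:P)) = root_part P p \Po ('X + a%:P).
Proof.
move=> /monic_root_seqE {1}-> P_per; rewrite prod_XsubC_shift.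
rewrite [root_part P p]/root_part prod_XsubC_shift.
have := root_part_prod_XsubC P [seq z - a | z <- root_seq p].
rewrite !big_map => ->.
by apply: eq_bigl => z; rewrite P_per.
Qed.

(** * Splitting the zeros into classes *)

Variables (T : eqType) (cl : F -> T).

Lemma prod_root_part (r : seq T) p : p \is monic -> uniq r ->
  (forall z, root p z -> cl z \in r) ->
  \prod_(c <- r) root_part (fun z => cl z == c) p = p.
Proof.
move=> p_mon r_uniq rootr; rewrite [RHS](monic_root_seqE p_mon).
under eq_bigr do rewrite /root_part big_mkcond.
(* With the product over zeros outermost, each factor ['X - z%:P] survives for exactly one index,
   namely [cl z]. *)
rewrite exchange_big; apply: eq_big_seq => z; rewrite mem_root_seq // => pz.
rewrite -big_mkcond /=; under eq_bigl do rewrite eq_sym.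
by rewrite prod_pred1_seq ?rootr.
Qed.

(** All zeros of [G d] lie in class [d], so taking the part of class [c] keeps [G c] whole and turns
    every other factor into 1. *)
Lemma root_part_prod_classes (r : seq T) (G : T -> {poly F}) c : uniq r ->
  {in r, forall d, G d \is monic} ->
  {in r, forall d z, root (G d) z -> cl z = d} ->
  root_part (fun z => cl z == c) (\prod_(d <- r) G d) =
  if c \in r then G c else 1.
Proof.
move=> r_uniq G_mon G_root; rewrite root_part_prod //.
have partG : {in r, forall d, root_part (fun z => cl z == c) (G d) =
    if d == c then G d else 1}.
  move=> d dr; case: eqVneq => [<-|neq_dc].
    by apply: root_part_id => [|z /(G_root d dr) ->]; rewrite ?G_mon.
  by apply: root_part_eq1 => [|z /(G_root d dr) ->]; rewrite ?G_mon.
rewrite (eq_big_seq _ partG) -big_mkcond; case: ifP => [cr|/negP cNr].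
  by rewrite prod_pred1_seq.
rewrite big1_seq // => d /andP[/eqP-> cr].
by case: cNr.
Qed.

End RootPart.

(** * Parts of a solution indexed by cosets *)

Section CosetPart.
Variables (R : realType) (alpha beta : R[i]).
Implicit Types (c : cosets alpha beta) (p q : {poly R[i]}).

Definition coset_part c p : {poly R[i]} :=
  root_part (fun z => \pi_(cosets alpha beta) z == c) p.

Lemma root_coset_part c p z : p \is monic ->
  root (coset_part c p) z = (\pi_(cosets alpha beta) z == c) && root p z.
Proof. exact: root_root_part. Qed.

Lemma pi_subr_period (z a : R[i]) : a \in period_group alpha beta ->
  \pi_(cosets alpha beta) (z - a) = \pi_(cosets alpha beta) z.
Proof.
move=> a_per; apply/eqP; rewrite -Quotient.idealrBE.
by rewrite addrAC subrr add0r rpredN.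
Qed.

Lemma coset_part_solution c p q : p \is monic -> q \is monic ->
  solution alpha beta p q ->
  solution alpha beta (coset_part c p) (coset_part c q).
Proof.
have alpha_per : alpha \in period_group alpha beta.
  by rewrite inE; apply/asboolP; exists 1, 0; rewrite mulr1z mulr0z addr0.
have beta_per : beta \in period_group alpha beta.
  by rewrite inE; apply/asboolP; exists 0, 1; rewrite mulr1z mulr0z add0r.
move=> p_mon q_mon; rewrite /solution => /(congr1 (coset_part c)).
rewrite /coset_part !root_partM ?monic_shift //.
by rewrite !root_part_shift // => z; rewrite pi_subr_period.
Qed.

Lemma coset_part_integral c p q : p \is monic -> q \is monic ->
  solution alpha beta p q ->
  integral_solution c (coset_part c p) (coset_part c q).
Proof.
move=> p_mon q_mon pq_sol; split; first exact: coset_part_solution.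
- by split; apply/monic_neq0/root_part_monic.
- by split; apply: root_part_monic.
by move=> z; rewrite rootM !root_coset_part // => /orP[] /andP[/eqP].
Qed.

(** Source of uniqueness: the left side depends on [p], [q] and [c] only, so every factorization has
    the same factor at [c]. *)
Lemma integral_factorization_coset_part p q (C : {fset cosets alpha beta}) pq c :
  integral_factorization p q C pq ->
  (coset_part c p, coset_part c q) = if c \in C then pq c else (1, 1).
Proof.
(* Both projections of the product ring are ring morphisms, so the identity splits into one for [p]
   and one for [q]. *)
move=> [pqC] /[dup] /(congr1 fst) + /(congr1 snd).
rewrite !rmorph_prod /= => -> ->.
rewrite /coset_part !root_part_prod_classes ?fset_uniq //.
- by case: (c \in C) => //; case: (pq c).
- by move=> d /pqC[[_ _ [_ ?] _] _].
- by move=> d /pqC[[_ _ _ rootd] _] z rz; apply: rootd; rewrite rootM rz orbT.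
- by move=> d /pqC[[_ _ [? _] _] _].
- by move=> d /pqC[[_ _ _ rootd] _] z rz; apply: rootd; rewrite rootM rz.
Qed.

(** Since factors equal to [(1, 1)] are excluded, the index set too can be read off from [p] and
    [q]. *)
Lemma mem_integral_factorization p q (C : {fset cosets alpha beta}) pq c :
  integral_factorization p q C pq ->
  (c \in C) = ((coset_part c p, coset_part c q) != (1, 1)).
Proof.
move=> fact; rewrite (integral_factorization_coset_part c fact).
have [pqC _] := fact; case: ifP => [/pqC[_ /eqP]|_]; last by rewrite eqxx.
by move=> ->.
Qed.

Lemma coset_part_factorization p q : p \is monic -> q \is monic ->
  solution alpha beta p q ->
  exists C : {fset cosets alpha beta},
    integral_factorization p q C (fun c => (coset_part c p, coset_part c q)).
Proof.
move=> p_mon q_mon pq_sol.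
pose cl (z : R[i]) := \pi_(cosets alpha beta) z.
(* The index set consists of the cosets that contain a zero of [p * q]. *)
exists [fset c in map cl (root_seq (p * q))]%fset.
have memC z : root (p * q) z ->
    cl z \in [fset c in map cl (root_seq (p * q))]%fset.
  by rewrite -mem_root_seq ?monicMl // inE; apply: map_f.
split=> [c|].
  rewrite inE => /mapP[z]; rewrite mem_root_seq ?monicMl // => pqz ->.
  split; first exact: coset_part_integral.
  (* If both parts at the coset of [z] were 1, then [z], a zero of [p] or of [q], would be a zero of
     1. *)
  case=> partp partq; have := pqz; rewrite rootM.
  have := root_coset_part (cl z) z p_mon; have := root_coset_part (cl z) z q_mon.
  by rewrite partp partq (negPf (root1 z)) eqxx /= => <- <-.
rewrite [RHS]surjective_pairing !rmorph_prod /= /coset_part.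
by congr (_, _); rewrite prod_root_part ?fset_uniq // => z rz; apply: memC;
  rewrite rootM rz ?orbT.
Qed.

End CosetPart.

Theorem lemma4p15 (R : realType) (alpha beta : R[i])
    (alpha_neq0 : alpha != 0) (beta_neq0 : beta != 0)
    (p q : {poly R[i]}) (p_neq0 : p != 0) (q_neq0 : q != 0)
    (p_monic : p \is monic) (q_monic : q \is monic)
    (pq_sol : solution alpha beta p q) :
  exists (C : {fset cosets alpha beta})
         (pq : cosets alpha beta -> {poly R[i]} * {poly R[i]}),
    integral_factorization p q C pq /\
    (forall (C' : {fset cosets alpha beta})
            (pq' : cosets alpha beta -> {poly R[i]} * {poly R[i]}),
       integral_factorization p q C' pq' ->
       C' = C /\ (forall c, c \in C -> pq' c = pq c)).
Proof.
have [C fact] := coset_part_factorization p_monic q_monic pq_sol.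
exists C, (fun c => (coset_part c p, coset_part c q)); split=> // C' pq' fact'.
have eqC : C' = C.
  apply/fsetP => c; rewrite (mem_integral_factorization c fact).
  by rewrite (mem_integral_factorization c fact').
split=> // c cC; rewrite (integral_factorization_coset_part c fact').
by rewrite eqC cC.
Qed.
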